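(* Let $X$ be an $n$-PCM. \begin{itemize} \item If $n \in \{-1,0\}$, then $X$ is also a smooth $n$-PCM. \item If $X$ is a simplicial complex of rank $n = 1$, then $X$ is also a smooth $n$-PCM. \item If $X$ is a simplicial complex of rank $n \geq 2$, and if for every $h \in \Delta X$ the poset $|\theta^{\square}_{\Delta X}(h)|$ is a discrete $(n-2)$-surface, then $X$ is also a smooth $n$-PCM. \end{itemize}
   Context: Posets. For a poset $X$ with order $\le$ and $h\in X$, put $\alpha_X(h)=\{h'\in X: h'\le h\}$, $\beta_X(h)=\{h'\in X: h'\ge h\}$, $\theta_X(h)=\alpha_X(h)\cup\beta_X(h)$, and let $\alpha^{\square}_X(h),\beta^{\square}_X(h),\theta^{\square}_X(h)$ be these sets with $h$ removed. Any subset $S\subseteq X$ is regarded as a poset $|S|$ with the induced order, so $\theta^{\square}_S(h)=\theta^{\square}_X(h)\cap S$ for $h\in S$. The rank $\mathrm{rk}(h,X)$ is $0$ if $\alpha^{\square}_X(h)=\emptyset$ and $1+\max_{x\in\alpha^{\square}_X(h)}\mathrm{rk}(x,X)$ otherwise; the rank of $X$ is the maximal rank of its elements, and $-1$ if $X=\emptyset$. A path is a finite sequence $\langle p^0,\dots,p^k\rangle$ in $X$ with $p^i\in\theta^{\square}_X(p^{i-1})$ for $1\le i\le k$; $X$ is connected if any two elements are joined by a path in $X$. Discrete surfaces. A CF-order is a countable poset with all $\theta_X(h)$ finite. A CF-order $X$ is a (discrete) $(-1)$-surface if $X=\emptyset$; a $0$-surface if $X=\{x,y\}$ with $x\neq y$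 and $x\notin\theta^{\square}_X(y)$; and, for $k\ge1$, a $k$-surface if it is non-empty, connected and $|\theta^{\square}_X(h)|$ is a $(k-1)$-surface for every $h\in X$. Border and PCM's. The border of a poset $X$ of rank $n\ge0$ is $\Delta X=\{h\in X: |\theta^{\square}_X(h)| \text{ is not an } (n-1)\text{-surface}\}$. A poset $X$ of rank $n$ is an $n$-PCM if: $n=-1$ and $X=\emptyset$; or $n=0$ and $X$ is a singleton; or $n\ge1$, $X$ is connected, $\Delta X\ne\emptyset$, and for every $h\in X$, $|\theta^{\square}_X(h)|$ is either an $(n-1)$-surface or an $(n-1)$-PCM. Smooth PCM's. A separated union of posets is a union of pairwise disjoint posets in which no element of one is comparable to an element of another. A poset $X$ of rank $n$ is a smooth $n$-PCM if: $n=-1$ and $X=\emptyset$; or $n=0$ and $X$ is a singleton; or $n\ge1$, $X$ is connected, its border $\Delta X\neq\emptyset$ is a discrete $(n-1)$-surface or a separated union of discrete $(n-1)$-surfaces, and for every $h\in X$, $|\theta^{\square}_X(h)|$ is either a smooth $(n-1)$-PCM (when $h\in\Delta X$) or an $(n-1)$-surface (when $h\notin\Delta X$). Simplicial complexes. A simplex is a non-empty finite set $h$, of dimension $\#h-1$. A simplicial complex is a finite set of simplices containing every non-empty subset of each of its elements; it is viewed as a poset ordered by inclusion, so that rank equals dimension. *)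

(* Defs.v *)
From mathcomp Require Import all_boot all_order all_algebra.
From mathcomp Require Import all_classical.

Set Implicit Arguments.
Unset Strict Implicit.
Unset Printing Implicit Defensive.

Import Order.TTheory GRing.Theory Num.Theory.
Local Open Scope classical_set_scope.
Local Open Scope ring_scope.

(* A poset is a subset [X : set T] of an ambient [T : porderType d], with the
   induced order; thus |S| for S a subset of X is just [S : set T].  Ranks and
   dimensions live in [int] because of the value -1. *)

Section Posets.
Variables (d : Order.disp_t) (T : porderType d).
Implicit Types (X S : set T) (h x y : T).

Definition alpha X h : set T := [set h' | X h' /\ (h' <= h)%O].
Definition beta X h : set T := [set h' | X h' /\ (h <= h')%O].
Definition theta X h : set T := alpha X h `|` beta X h.
Definition alpha_sq X h : set T := alpha X h `\ h.
Definition beta_sq X h : set T := beta X h `\ h.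
Definition theta_sq X h : set T := theta X h `\ h.

(* [has_rk X h k] is the graph of the recursive equation
   rk(h, X) = 0 if alpha_sq X h is empty, 1 + max_(x in alpha_sq X h) rk(x, X)
   otherwise.  It is a relation because, in a general poset, the recursion need
   not terminate and the maximum need not exist.  In the second constructor
   [r] gives the ranks of the elements below [h], and [k] is their maximum. *)
Inductive has_rk X h : nat -> Prop :=
| has_rk0 : alpha_sq X h = set0 -> has_rk X h 0
| has_rkS (r : T -> nat) (k : nat) :
    (forall x, alpha_sq X h x -> has_rk X x (r x)) ->
    (exists2 x, alpha_sq X h x & r x = k) ->
    (forall x, alpha_sq X h x -> (r x <= k)%N) ->
    has_rk X h k.+1.

Definition poset_rank X (n : int) : Prop :=
  (X = set0 /\ n = -1) \/
  exists m : nat, [/\ n = m%:Z,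
    exists2 h, X h & has_rk X h m &
    forall h, X h -> exists2 k, has_rk X h k & (k <= m)%N].

(* [p 0, ..., p k] is the path; the values of [p] beyond [k] are irrelevant. *)
Definition is_path X (k : nat) (p : nat -> T) : Prop :=
  (forall i, (i <= k)%N -> X (p i)) /\
  (forall i, (i < k)%N -> theta_sq X (p i) (p i.+1)).

Definition poset_connected X : Prop :=
  forall x y, X x -> X y ->
    exists k p, [/\ is_path X k p, p 0%N = x & p k = y].

Definition CF_order X : Prop :=
  countable X /\ forall h, X h -> finite_set (theta X h).

Inductive surface : int -> set T -> Prop :=
| surface_m1 X : CF_order X -> X = set0 -> surface (-1) X
| surface_0 X : CF_order X ->
    (exists x y, [/\ X = [set x; y], x <> y & ~ theta_sq X y x]) ->
    surface 0 X
| surface_ge1 k X : CF_order X -> 1 <= k ->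
    X !=set0 -> poset_connected X ->
    (forall h, X h -> surface (k - 1) (theta_sq X h)) ->
    surface k X.

(* The border of a poset [X] of rank [n]; only used when [n] is the rank. *)
Definition border (n : int) X : set T :=
  [set h | X h /\ ~ surface (n - 1) (theta_sq X h)].

Inductive pcm : int -> set T -> Prop :=
| pcm_m1 X : poset_rank X (-1) -> X = set0 -> pcm (-1) X
| pcm_0 X : poset_rank X 0 -> (exists x, X = [set x]) -> pcm 0 X
| pcm_ge1 n X : poset_rank X n -> 1 <= n ->
    poset_connected X -> border n X !=set0 ->
    (forall h, X h ->
       surface (n - 1) (theta_sq X h) \/ pcm (n - 1) (theta_sq X h)) ->
    pcm n X.

Definition separated_union (F : set (set T)) X : Prop :=
  [/\ X = \bigcup_(S in F) S, trivIset F id &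
      forall S S', F S -> F S' -> S <> S' ->
        forall x y, S x -> S' y -> (x >< y)%O].

Inductive smooth_pcm : int -> set T -> Prop :=
| smooth_pcm_m1 X : poset_rank X (-1) -> X = set0 -> smooth_pcm (-1) X
| smooth_pcm_0 X : poset_rank X 0 -> (exists x, X = [set x]) -> smooth_pcm 0 X
| smooth_pcm_ge1 n X : poset_rank X n -> 1 <= n ->
    poset_connected X -> border n X !=set0 ->
    (surface (n - 1) (border n X) \/
     exists2 F, separated_union F (border n X) &
                forall S, F S -> surface (n - 1) S) ->
    (forall h, border n X h -> smooth_pcm (n - 1) (theta_sq X h)) ->
    (forall h, X h -> ~ border n X h -> surface (n - 1) (theta_sq X h)) ->
    smooth_pcm n X.

End Posets.

Section SimplicialComplexes.
Variable V : Type.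

Definition simplex (h : set V) : Prop := finite_set h /\ h !=set0.

(* The inclusion order on [set V] is the library's canonical one, so that a
   simplicial complex is directly a poset in the sense above. *)
Definition simplicial_complex (X : set (set V)) : Prop :=
  [/\ finite_set X, forall h, X h -> simplex h &
      forall h h', X h -> h' `<=` h -> h' !=set0 -> X h'].

End SimplicialComplexes.

(* Main.v *)
Require Import Defs.
From mathcomp Require Import all_boot all_order all_algebra finmap zify.
From mathcomp Require Import all_classical.

Set Implicit Arguments.
Unset Strict Implicit.
Unset Printing Implicit Defensive.

Import Order.TTheory GRing.Theory Num.Theory.
Local Open Scope classical_set_scope.
Local Open Scope ring_scope.

(** A [-1]- or [0]-dimensional PCM is smooth by definition, so only simplicial
    complexes of rank [n >= 1] require an argument.

    Rank [n >= 2].  The theorem is local to flags.  For a flag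
    [h1 < ... < hj] of border elements, its link is the set of the elements of
    [X] comparable to, and different from, every [hi].  Links of flags are
    obtained by iterating [theta_sq], so they inherit a lot from [X]
    ([flag_link_border_surface], [flag_link_interior_surface]): since the links
    in [border n X] are surfaces, the border elements in the link [Y] of a flag
    form a surface, and the link in [Y] of a non-border element is a surface
    too.  By recursion on the dimension, all links of nonempty flags are smooth
    PCMs as soon as none of them is a surface ([flag_link_smooth]): that
    condition puts each of them in the PCM branch of the definition, and
    identifies the border of [Y] with the border elements of [X] lying in [Y].
    The border of [X] itself is the separated union of its connected
    components ([separated_components]).

    That no such link is a surface is where simpliciality enters.  Below an
    element [h] of a complex sits the whole boundary of the simplex [h], and
    between [g < h] sits the boundary of the simplex with vertices [h] minus
    [g]; these are spheres ([open_interval_surface]).  Hence the link of a flag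
    with top element [h] is the ordinal sum of a sphere [A] with the part
    [beta_sq X h] above [h].  An ordinal sum of finite surfaces is a surface
    ([surface_join]), and conversely a surface summand can be cancelled
    ([surface_join_cancel]).  So if the link of the flag were a surface,
    [beta_sq X h] would be one, and then so would [theta_sq X h], which is the
    ordinal sum of the boundary of [h] with [beta_sq X h]: the top [h] would not
    be a border element ([simplicial_flag_link_nsurface]).

    Rank [n = 1].  Border elements are the elements comparable to exactly one
    other element instead of two.  By the handshake lemma their number is even,
    so they can be grouped into pairs ([smooth_pcm1]).  In a complex they are
    vertices ([simplicial_border1]), hence pairwise incomparable, and the pairs
    are separated [0]-surfaces. *)

(** * Comparability and ordinal sums *)

Section Posets.
Variables (d : Order.disp_t) (T : porderType d).
Implicit Types (X Y A B D : set T) (h x y : T) (k p q n : int).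

Lemma theta_sqP X h y :
  theta_sq X h y <-> [/\ X y, y <> h & (y >=< h)%O].
Proof.
split.
  by case=> -[[Xy yh]|[Xy yh]] /= ne; split; rewrite // /Order.comparable yh ?orbT.
by case=> Xy ne /orP[yh|yh]; split => //; [left|right].
Qed.

Lemma theta_sq_sym X h y : X h -> theta_sq X h y -> theta_sq X y h.
Proof.
move=> Xh /theta_sqP[Xy ne c]; apply/theta_sqP; split => //.
  by move=> e; apply: ne.
by rewrite comparable_sym.
Qed.

Lemma theta_sq_sub X h : theta_sq X h `<=` X.
Proof. by move=> y /theta_sqP[]. Qed.

Lemma theta_sq_setI X Y h : theta_sq X h `&` Y = theta_sq (X `&` Y) h.
Proof.
apply/seteqP; split=> y /=.
  by case=> /theta_sqP[Xy ne c] Yy; apply/theta_sqP.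
by move/theta_sqP=> [[Xy Yy] ne c]; split => //; apply/theta_sqP.
Qed.

(** Comparability is symmetric, so the link of a flag does not depend on the
    order in which its elements are treated. *)
Lemma theta_sqC X h y : theta_sq (theta_sq X h) y = theta_sq (theta_sq X y) h.
Proof.
apply/seteqP; split=> z /theta_sqP[/theta_sqP[Xz n1 c1] n2 c2];
  by do 2 (apply/theta_sqP; split=> //).
Qed.

Lemma theta_sqU_lower A B h : (forall b, B b -> (h < b)%O) ->
  theta_sq (A `|` B) h = theta_sq A h `|` B.
Proof.
move=> hB; apply/seteqP; split=> y.
  move/theta_sqP=> [[Ay|By] ne c]; [left|by right].
  by apply/theta_sqP.
case=> [/theta_sqP[Ay ne c]|By]; apply/theta_sqP; split=> //.
- by left.
- by right.
- by move=> e; move: (hB _ By); rewrite e ltxx.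
- by rewrite comparable_sym lt_comparable // hB.
Qed.

Lemma theta_sqU_upper A B h : (forall a, A a -> (a < h)%O) ->
  theta_sq (A `|` B) h = A `|` theta_sq B h.
Proof.
move=> Ah; apply/seteqP; split=> y.
  move/theta_sqP=> [[Ay|By] ne c]; [by left|right].
  by apply/theta_sqP.
case=> [Ay|/theta_sqP[By ne c]]; apply/theta_sqP; split=> //.
- by left.
- by move=> e; move: (Ah _ Ay); rewrite e ltxx.
- by rewrite lt_comparable // Ah.
- by right.
Qed.

(** * Connectivity *)

Definition linked X x y :=
  exists (l : nat) (w : nat -> T), [/\ is_path X l w, w 0%N = x & w l = y].

Lemma linked_refl X x : X x -> linked X x x.
Proof. by move=> Xx; exists 0%N, (fun=> x). Qed.

Lemma linked_rcons X x y z : linked X x y -> X z -> (y >=< z)%O -> linked X x z.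
Proof.
move=> xy Xz yz; have [<-//|ne] := eqVneq y z.
case: xy => k [p [[Xp sp] p0 pk]].
exists k.+1, (fun i => if (i <= k)%N then p i else z); split.
- split=> [i|i].
    by case: ifP => // ik _; exact: Xp.
  rewrite ltnS leq_eqVlt => /orP[/eqP->|ik].
    rewrite /= eqxx ltnn pk; apply/theta_sqP; split=> //.
      by move=> e; rewrite e eqxx in ne.
    by rewrite comparable_sym.
  by rewrite /= ik orbT; exact: sp.
- by [].
- by rewrite /= ltnn.
Qed.

(** Induction along a path, through which all further properties of [linked]
    are obtained without handling the function that encodes a path. *)
Lemma linked_ind X (P : T -> Prop) x y : P x ->
  (forall u v, P u -> X u -> X v -> (u >=< v)%O -> P v) ->
  linked X x y -> P y.
Proof.
move=> Px step [k [p [[Xp sp] p0 <-]]].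
suff: forall i, (i <= k)%N -> P (p i) by apply.
elim=> [|i IH] ik; first by rewrite p0.
have /theta_sqP[_ _ c] := sp _ ik.
apply: (step (p i)); [exact/IH/ltnW|exact/Xp/ltnW|exact: Xp|].
by rewrite comparable_sym.
Qed.

Lemma linked_in X x y : linked X x y -> X x /\ X y.
Proof. by move=> [k [p [[Xp _] <- <-]]]; split; apply: Xp. Qed.

Lemma linked_trans X x y z : linked X x y -> linked X y z -> linked X x z.
Proof.
move=> xy; apply: (linked_ind (P := linked X x)) => // u v xu _ Xv uv.
exact: linked_rcons uv.
Qed.

Lemma linked_sym X x y : linked X x y -> linked X y x.
Proof.
move=> xy; have [Xx _] := linked_in xy.
move: xy; apply: (linked_ind (P := linked X ^~ x)) => [|u v ux Xu Xv uv].
  exact: linked_refl.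
apply: linked_trans ux; apply: linked_rcons (linked_refl Xv) Xu _.
by rewrite comparable_sym.
Qed.

(** * Surfaces *)

Lemma CF_order_finite X : finite_set X -> CF_order X.
Proof.
move=> fX; split; first exact: finite_set_countable.
by move=> h Xh; apply: sub_finite_set fX => y [[]|[]].
Qed.

Lemma surface_inv k X : surface k X ->
  [\/ k = -1 /\ X = set0,
      k = 0 /\ exists x y, [/\ X = [set x; y], x <> y & ~ theta_sq X y x] |
      [/\ 1 <= k, X !=set0 & forall h, X h -> surface (k - 1) (theta_sq X h)]].
Proof.
by case=> {k X} [X _|X _|k X _ ? ? _ ?];
  [constructor 1|constructor 2|constructor 3].
Qed.

Lemma surface_dim k X h : surface k X -> X h -> 0 <= k.
Proof.
by case/surface_inv=> [[_ ->]|[-> _]|[k1 _ _]] // _; lia.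
Qed.

Lemma surface_dim_ge k X : surface k X -> -1 <= k.
Proof. by case/surface_inv=> [[-> _]|[-> _]|[k1 _ _]] //; lia. Qed.

Lemma surface_neq0 k X : surface k X -> 0 <= k -> X !=set0.
Proof.
case/surface_inv=> [[-> _]|[_ [x [y [-> _ _]]]]|[_ //]] // _.
by exists x; left.
Qed.

Lemma surface_m1E X : surface (-1) X -> X = set0.
Proof.
by case/surface_inv=> [[_ ->]|[? _]|[? _ _]] //; lia.
Qed.

Lemma surface_set0 : surface (-1) (set0 : set T).
Proof. by apply: surface_m1 => //; exact/CF_order_finite. Qed.

(** The definition says this for [k >= 1] only; the link of either point of a
    [0]-surface is empty. *)
Lemma surface_theta_sq k X h : surface k X -> X h ->
  surface (k - 1) (theta_sq X h).
Proof.
case/surface_inv=> [[_ ->]//|[-> [x [y [-> xy nyx]]]]|[_ _ +]]; last exact.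
move=> Xh; suff -> : theta_sq [set x; y] h = set0 by exact: surface_set0.
rewrite -subset0 => z /theta_sqP[Xz zh c]; apply: nyx; apply/theta_sqP.
case: Xz Xh zh c => -> [] -> //= zh c; split=> //; [by left|by left|].
by rewrite comparable_sym.
Qed.

(** Every element of the ordinal sum has as link the ordinal sum of its link in
    its own summand with the other summand, so induction on the total dimension
    applies; a point of one summand connects all points of the other.
    Finiteness keeps [theta] finite: each element of [A] is below all of [B]. *)
Lemma surface_join p q A B : finite_set A -> finite_set B ->
  (forall a b, A a -> B b -> (a < b)%O) ->
  surface p A -> surface q B -> surface (p + q + 1) (A `|` B).
Proof.
have [N] : exists N : nat, p + q <= N%:Z - 2 by exists (absz (p + q + 2)); lia.
elim: N p q A B => [|N IH] p q A B leN fA fB ltAB sA sB.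
  have p1 := surface_dim_ge sA; have q1 := surface_dim_ge sB.
  have [ep eq] : p = -1 /\ q = -1 by lia.
  rewrite ep in sA; rewrite eq in sB.
  by rewrite (surface_m1E sA) (surface_m1E sB) setU0 ep eq; exact: surface_set0.
have [ep|p0] : p = -1 \/ 0 <= p by have := surface_dim_ge sA; lia.
  rewrite ep in sA; rewrite (surface_m1E sA) set0U.
  by have -> : p + q + 1 = q by lia.
have [eq|q0] : q = -1 \/ 0 <= q by have := surface_dim_ge sB; lia.
  rewrite eq in sB; rewrite (surface_m1E sB) setU0.
  by have -> : p + q + 1 = p by lia.
have [a Aa] := surface_neq0 sA p0; have [b Bb] := surface_neq0 sB q0.
apply: surface_ge1.
- by apply: CF_order_finite; rewrite finite_setU.
- by lia.
- by exists a; left.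
- have ab : linked (A `|` B) a b.
    apply: linked_rcons (linked_refl _) _ _; [by left|by right|].
    exact/lt_comparable/ltAB.
  have la x : (A `|` B) x -> linked (A `|` B) x a.
    case=> [Ax|Bx]; last first.
      apply: linked_rcons (linked_refl _) _ _; [by right|by left|].
      by rewrite comparable_sym; exact/lt_comparable/ltAB.
    apply: linked_trans (linked_sym ab).
    apply: linked_rcons (linked_refl _) _ _; [by left|by right|].
    exact/lt_comparable/ltAB.
  by move=> x y /la xa /la ya; exact: linked_trans xa (linked_sym ya).
- move=> h [Ah|Bh].
    rewrite theta_sqU_lower; last by move=> ? ?; exact: ltAB.
    have -> : p + q + 1 - 1 = (p - 1) + q + 1 by lia.
    apply: IH => //; [by lia| | |exact: surface_theta_sq].
    + exact: sub_finite_set (@theta_sq_sub _ _) fA.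
    + by move=> x y /theta_sq_sub; exact: ltAB.
  rewrite theta_sqU_upper; last by move=> ? ?; exact: ltAB.
  have -> : p + q + 1 - 1 = p + (q - 1) + 1 by lia.
  apply: IH => //; [by lia| | |exact: surface_theta_sq].
  + exact: sub_finite_set (@theta_sq_sub _ _) fB.
  + by move=> x y ? /theta_sq_sub; exact: ltAB.
Qed.

(** Passing to the link of a point of [A] lowers the dimensions of [A] and of
    the sum by one and does not change [B]; repeat until [A] is empty. *)
Lemma surface_join_cancel k p A B :
  (forall a b, A a -> B b -> (a < b)%O) ->
  surface p A -> surface k (A `|` B) -> surface (k - p - 1) B.
Proof.
have [N] : exists N : nat, p <= N%:Z - 1 by exists (absz (p + 1)); lia.
elim: N k p A => [|N IH] k p A leN ltAB sA sAB.
  have ep : p = -1 by have := surface_dim_ge sA; lia.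
  rewrite ep in sA *; move: sAB; rewrite (surface_m1E sA) set0U.
  by have -> : k - -1 - 1 = k by lia.
have [ep|p0] : p = -1 \/ 0 <= p by have := surface_dim_ge sA; lia.
  by apply: IH sAB => //; lia.
have [a Aa] := surface_neq0 sA p0.
have := surface_theta_sq sAB (or_introl Aa : (A `|` B) a).
rewrite theta_sqU_lower; last by move=> ? ?; exact: ltAB.
have -> : k - p - 1 = k - 1 - (p - 1) - 1 by lia.
apply: IH; [by lia| |exact: surface_theta_sq].
by move=> x y /theta_sq_sub; exact: ltAB.
Qed.

Definition open_interval (x y : T) : set T := [set z | (x < z < y)%O].

End Posets.

(** * Spheres in the inclusion order *)

Section SubsetCardinal.
Variable V : Type.
Implicit Types g h x A B : set V.

(** [V] is an arbitrary type, while finite sets with a cardinal need a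
    [choiceType]; the classical alias provides one. *)
Definition set_card A : nat := #|` fset_set (A : set {classic V})|%fset.

Lemma set_card0 : set_card set0 = 0%N.
Proof. by rewrite /set_card fset_set0 cardfs0. Qed.

Lemma subset_set_card A B : finite_set B -> A `<=` B -> (set_card A <= set_card B)%N.
Proof.
move=> fB AB; apply: fsubset_leq_card.
by rewrite -fset_set_sub //; exact: sub_finite_set fB.
Qed.

Lemma set_cardU1 a A : finite_set A -> ~ A a -> set_card (a |` A) = (set_card A).+1.
Proof.
move=> fA nAa; rewrite /set_card (@fset_setU1 {classic V}) // cardfsU1.
by rewrite in_fset_set // memNset.
Qed.

Lemma proper_set_card A B : finite_set B -> A `<=` B -> A <> B ->
  (set_card A < set_card B)%N.
Proof.
move=> fB AB ne; have fA := sub_finite_set AB fB.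
have [b Bb nAb] : exists2 b, B b & ~ A b.
  apply: contra_notP ne => nb; apply/seteqP; split=> // b Bb.
  by apply: contrapT => nAb; apply: nb; exists b.
rewrite -(set_cardU1 fA nAb); apply: subset_set_card => //.
by move=> x [->|/AB].
Qed.

Lemma setltP g h : reflect (g `<=` h /\ g <> h) (g < h)%O.
Proof.
rewrite lt_def; apply: (iffP andP) => -[H1 H2].
  split; first by rewrite -subsetEset.
  by move=> e; rewrite e eqxx in H1.
by split; [apply/eqP => e; apply: H2|rewrite subsetEset].
Qed.

Lemma finite_subsets h : finite_set h -> finite_set [set x | x `<=` h].
Proof.
move=> fh; have fE (A : set {classic V}) := @fset_setK {classic V} A.
pose f (A : {fset {classic V}}) : set V := [set` A].
apply: sub_finite_set (finite_image f (finite_fset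
  (fpowerset (fset_set (h : set {classic V}))))).
move=> x xh; have fx := sub_finite_set xh fh.
exists (fset_set (x : set {classic V})); last exact: fE.
by rewrite /= fpowersetE -(@fset_set_sub {classic V}).
Qed.

(** The interval is the boundary of the simplex on the vertices of [h] outside
    [g].  The link of [x] splits at [x] into two smaller intervals, whose
    ordinal sum is a surface by induction.  What remains is connectedness, when
    at least three vertices are available: any [x] is linked to the one-vertex
    extension of [g] by one of its points, and two such extensions are linked
    through their union, which is then still different from [h]. *)
Lemma open_interval_surface g h : finite_set h -> (g < h)%O ->
  surface ((set_card h)%:Z - (set_card g)%:Z - 2) (open_interval g h).
Proof.
have [N] : exists N, (set_card h - set_card g <= N)%N
  by exists (set_card h - set_card g)%N.
elim: N g h => [|N IH] g h leN fh gh.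
  have /setltP[sgh ngh] := gh.
  by have := proper_set_card fh sgh ngh; lia.
have /setltP[sgh ngh] := gh; have cgh := proper_set_card fh sgh ngh.
have fg := sub_finite_set sgh fh.
have lt_card x : open_interval g h x ->
    [/\ finite_set x, (set_card g < set_card x)%N & (set_card x < set_card h)%N].
  move=> /andP[/setltP[gx ngx] /setltP[xh nxh]].
  have fx := sub_finite_set xh fh.
  by split=> //; exact: proper_set_card.
have finI : finite_set (open_interval g h).
  apply: sub_finite_set (finite_subsets fh) => x.
  by move=> /andP[_ /setltP[]].
have extra_point u x : finite_set x -> u `<=` x -> (set_card u < set_card x)%N ->
    exists2 a, x a & ~ u a.
  move=> fx ux ltc; apply: contrapT => nb; suff: u = x 
    by move=> e; rewrite e ltnn in ltc.
  apply/seteqP; split=> // b xb.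
  by apply: contrapT => nub; apply: nb; exists b.
have atom a : h a -> ~ g a -> (set_card g + 2 <= set_card h)%N ->
    open_interval g h (a |` g).
  move=> ha nga c2; have := set_cardU1 fg nga => ca.
  apply/andP; split; apply/setltP; split.
  - by move=> x; right.
  - by move=> e; apply: nga; rewrite e; left.
  - by move=> x [->|/sgh].
  - by move=> e; rewrite e in ca; lia.
(* Dimensions [-1] and [0] are separate clauses of the definition. *)
have [c1|c1] : set_card h = (set_card g).+1 \/ (set_card g + 2 <= set_card h)%N by lia.
  have -> : open_interval g h = set0.
    by rewrite -subset0 => x /lt_card[_ ? ?]; lia.
  have -> : (set_card h)%:Z - (set_card g)%:Z - 2 = -1 by lia.
  exact: surface_set0.
have [a ha nga] := extra_point _ _ fh sgh cgh.
have [c2|c2] : set_card h = (set_card g).+2 \/ (set_card g + 3 <= set_card h)%N by lia.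
  have Ia := atom _ ha nga c1.
  have sah : a |` g `<=` h by move=> x [->|/sgh].
  have [|b hb nab] := extra_point (a |` g) h fh sah;
    first by rewrite set_cardU1 //; lia.
  have ngb : ~ g b by move=> gb; apply: nab; right.
  have Ib := atom _ hb ngb c1.
  have hE : b |` (a |` g) = h.
    apply: contrapT => ne.
    have [_ _ ca] := lt_card _ Ia.
    have fag : finite_set (a |` g) by rewrite finite_setU.
    have := @proper_set_card (b |` (a |` g)) h fh.
    rewrite !set_cardU1 // => H; have: ((set_card g).+2 < set_card h)%N.
      by apply: H => // x [->|/sah].
    by rewrite c2 ltnn.
  have -> : (set_card h)%:Z - (set_card g)%:Z - 2 = 0 by lia.
  (* All elements of the interval have one vertex more than [g], so no two of
     them are nested. *)
  have max u x : open_interval g h u -> open_interval g h x -> u `<=` x ->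
      u = x.
    move=> /lt_card[fu ? ?] /lt_card[fx ? ?] ux; apply: contrapT => ne.
    by have := proper_set_card fx ux ne; lia.
  apply: surface_0; first exact: CF_order_finite.
  exists (a |` g), (b |` g); split.
  - apply/seteqP; split=> x; last by case=> ->.
    move=> Ix; have [fx gx xh] := lt_card _ Ix.
    have /andP[/setltP[sgx _] /setltP[sxh _]] := Ix.
    have [y xy ngy] := extra_point _ _ fx sgx gx.
    have := sxh _ xy; rewrite -hE => -[yb|[ya|//]]; [right|left];
      apply/esym/max => // z [->|/sgx //]; by rewrite -?yb -?ya.
  - by move=> e; apply: nab; rewrite e; left.
  - move/theta_sqP=> [_ ne /orP[]]; rewrite subsetEset => s; apply: ne.
    + exact: max.
    + exact/esym/max.
have IHI x : open_interval g h x ->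
    surface ((set_card h)%:Z - (set_card g)%:Z - 2 - 1)
      (theta_sq (open_interval g h) x).
  move=> Ix; have [fx gx xh] := lt_card _ Ix.
  have /andP[ltgx ltxh] := Ix.
  have lt_trans3 y z : open_interval g x y -> open_interval x h z -> (y < z)%O.
    by move=> /andP[_ yx] /andP[xz _]; exact: lt_trans xz.
  have IE : theta_sq (open_interval g h) x =
      open_interval g x `|` open_interval x h.
    apply/seteqP; split=> y.
      move/theta_sqP=> [/andP[gy yh] /eqP ne].
      by rewrite /Order.comparable !le_eqVlt [x == y]eq_sym (negPf ne) /=
        => /orP[yx|xy]; [left|right]; apply/andP.
    case=> /andP[H1 H2]; apply/theta_sqP; split.
    - by apply/andP; split=> //; exact: lt_trans ltxh.
    - by move=> e; move: H2; rewrite e ltxx.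
    - by rewrite lt_comparable.
    - by apply/andP; split=> //; exact: lt_trans H1.
    - by move=> e; move: H1; rewrite e ltxx.
    - by rewrite comparable_sym lt_comparable.
  have -> : (set_card h)%:Z - (set_card g)%:Z - 2 - 1 =
      ((set_card x)%:Z - (set_card g)%:Z - 2) +
      ((set_card h)%:Z - (set_card x)%:Z - 2) + 1.
    by lia.
  rewrite IE; apply: surface_join => //.
  - by apply: sub_finite_set (finite_subsets fx) => y /andP[_ /setltP[]].
  - by apply: sub_finite_set (finite_subsets fh) => y /andP[_ /setltP[]].
  - by apply: IH => //; lia.
  - by apply: IH => //; lia.
apply: surface_ge1 => //; [exact: CF_order_finite|by lia| |].
  by exists (a |` g); exact: atom.
have pair_linked u v : h u -> ~ g u -> h v -> ~ g v ->
    linked (open_interval g h) (u |` g) (v |` g).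
  move=> hu ngu hv ngv; have Iu := atom _ hu ngu c1.
  have Iv := atom _ hv ngv c1.
  have [e|nuv] := pselect (u = v); first by rewrite e; exact: linked_refl.
  have cuv : set_card (v |` (u |` g)) = (set_card g).+2.
    have fug : finite_set (u |` g) by rewrite finite_setU.
    by rewrite !set_cardU1 //; case=> // /esym.
  have Iuv : open_interval g h (v |` (u |` g)).
    apply/andP; split; apply/setltP; split.
    - by move=> x gx; right; right.
    - by move=> e; rewrite -e in cuv; lia.
    - by move=> x [->|[->|/sgh]].
    - by move=> e; rewrite e in cuv; lia.
  apply: (@linked_rcons _ _ _ _ (v |` (u |` g))) => //.
    apply: linked_rcons (linked_refl Iu) Iuv _.
    by apply/orP; left; rewrite subsetEset => x; right.
  apply/orP; right; rewrite subsetEset => x [->|gx]; first by left.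
  by right; right.
have atom_below x : open_interval g h x -> exists u,
    [/\ h u, ~ g u & linked (open_interval g h) (u |` g) x].
  move=> Ix; have [fx gx xh] := lt_card _ Ix.
  have /andP[/setltP[sgx _] /setltP[sxh _]] := Ix.
  have [u xu ngu] := extra_point _ _ fx sgx gx.
  exists u; split=> //; first exact: sxh.
  apply: linked_rcons (linked_refl (atom _ (sxh _ xu) ngu c1)) Ix _.
  by apply/orP; left; rewrite subsetEset => z [->|/sgx].
move=> x y /atom_below[u [hu ngu ux]] /atom_below[v [hv ngv vy]].
apply: linked_trans (linked_sym ux) _; apply: linked_trans vy.
exact: pair_linked.
Qed.
End SubsetCardinal.

(** * Components of the border, and links of border flags *)

Section PCMs.
Variables (d : Order.disp_t) (T : porderType d).
Implicit Types (X Y A B D : set T) (h x y : T) (k p q n : int).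

Lemma pcm_inv n X : pcm n X ->
  [\/ [/\ n = -1, poset_rank X (-1) & X = set0],
      [/\ n = 0, poset_rank X 0 & exists x, X = [set x]] |
      [/\ 1 <= n, poset_rank X n, poset_connected X, border n X !=set0 &
          forall h, X h ->
            surface (n - 1) (theta_sq X h) \/ pcm (n - 1) (theta_sq X h)]].
Proof.
by case=> {n X} [X ? ?|X ? ?|n X *];
  [constructor 1|constructor 2|constructor 3].
Qed.

Lemma smooth_pcm_small n X : n < 1 -> pcm n X -> smooth_pcm n X.
Proof.
move=> n1 /pcm_inv[[-> rX X0]|[-> rX X1]|[n1' _ _ _ _]].
- exact: smooth_pcm_m1.
- exact: smooth_pcm_0.
- by lia.
Qed.

(** Comparable elements lie in the same connected component, so components are
    separated and have the same links as the whole. *)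
Lemma separated_components n D : finite_set D -> 1 <= n ->
  (forall h, D h -> surface (n - 1) (theta_sq D h)) ->
  exists2 F, separated_union F D & forall S, F S -> surface n S.
Proof.
move=> fD n1 sD.
exists [set S | exists2 x, D x & S = [set y | linked D x y]].
  have same x y : linked D x y ->
      [set z | linked D x z] = [set z | linked D y z].
    move=> xy; apply/seteqP; split=> z /= l.
      exact: linked_trans (linked_sym xy) l.
    exact: linked_trans xy l.
  split.
  - apply/seteqP; split=> x.
      by move=> Dx; exists [set y | linked D x y]; [exists x|exact: linked_refl].
    by case=> _ [y _ ->] /= yx; have [] := linked_in yx.
  - move=> _ _ [x _ ->] [y _ ->] [z [/= xz yz]]; apply: same.
    exact: linked_trans xz (linked_sym yz).
  - move=> _ _ [x _ ->] [y _ ->] ne u v /= xu yv; apply/negP => uv; apply: ne.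
    apply: same; have [_ Dv] := linked_in yv.
    exact: linked_trans (linked_rcons xu Dv uv) (linked_sym yv).
move=> _ [x Dx ->].
have fS : finite_set [set y | linked D x y].
  by apply: sub_finite_set fD => y /= xy; have [] := linked_in xy.
apply: surface_ge1 => //.
- exact: CF_order_finite.
- by exists x; exact: linked_refl.
- suff lx y : linked D x y -> linked [set y | linked D x y] x y.
    by move=> y z /lx xy /lx xz; exact: linked_trans (linked_sym xy) xz.
  move=> xy; have [] // : linked D x y /\ linked [set y | linked D x y] x y.
  move: xy; apply: (linked_ind
    (P := fun y => linked D x y /\ linked [set y | linked D x y] x y)).
    by split; apply: linked_refl => //; exact: linked_refl.
  move=> u v [xu lxu] Du Dv uv; have xv := linked_rcons xu Dv uv.
  by split=> //; exact: linked_rcons uv.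
- move=> h /= xh; have [_ Dh] := linked_in xh.
  suff -> : theta_sq [set y | linked D x y] h = theta_sq D h by exact: sD.
  apply/seteqP; split=> y /theta_sqP[ly ne c]; apply/theta_sqP; split=> //.
    by have [] := linked_in ly.
  by apply: linked_rcons xh ly _; rewrite comparable_sym.
Qed.

(** [flag_link X n k Y]: [Y] is the link in [X] of a nonempty flag of border
    elements, and [k] is [n] minus the length of that flag, the dimension that
    [Y] has if it is a surface or a PCM. *)
Inductive flag_link X n : int -> set T -> Prop :=
| flag_link1 h : border n X h -> flag_link X n (n - 1) (theta_sq X h)
| flag_linkS k Y h : flag_link X n k Y -> Y h -> border n X h ->
    flag_link X n (k - 1) (theta_sq Y h).

Section FlagLinks.
Variables (X : set T) (n : int).
Local Notation D := (border n X).
Local Notation fl := (flag_link X n).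
Hypothesis n2 : 2 <= n.
Hypothesis pX : pcm n X.
Hypothesis border_link : forall h, D h -> surface (n - 2) (theta_sq D h).
Hypothesis flag_link_nsurface : forall k Y, fl k Y -> ~ surface k Y.

(** Intersecting with the border commutes with taking links, and iterated links
    of a surface are surfaces. *)
Lemma flag_link_border_surface k Y : fl k Y -> surface (k - 1) (Y `&` D).
Proof.
elim=> {k Y} [h Dh|k Y h _ IH Yh Dh].
  rewrite theta_sq_setI; have -> : X `&` D = D by apply: setIidr => x [].
  by have -> : n - 1 - 1 = n - 2; [lia|exact: border_link].
by rewrite theta_sq_setI; exact: surface_theta_sq.
Qed.

(** The links may be taken in another order: first that of [h], which is a
    surface since [h] is not in the border, then those of the flag. *)
Lemma flag_link_interior_surface k Y h : fl k Y -> Y h -> ~ D h ->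
  surface (k - 1) (theta_sq Y h).
Proof.
move=> flY; elim: flY h => {k Y} [g [Xg _]|k Y g _ IH Yg Dg] h hY nDh.
  have Xh := theta_sq_sub hY.
  rewrite theta_sqC; apply: surface_theta_sq (theta_sq_sym Xg hY).
  by apply: contrapT => ns; apply: nDh.
rewrite theta_sqC; apply: surface_theta_sq (theta_sq_sym Yg hY).
by apply: IH => //; exact: theta_sq_sub hY.
Qed.

Lemma flag_link_pcm k Y : fl k Y -> pcm k Y.
Proof.
elim=> {k Y} [h Dh|k Y h flY IH Yh Dh].
  have [[? _ _]|[? _ _]|[_ _ _ _ links]] := pcm_inv pX; try lia.
  by have [/(flag_link_nsurface (flag_link1 Dh))|] := links _ (proj1 Dh).
have k1 := surface_dim (flag_link_border_surface flY) (conj Yh Dh).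
have [[? _ _]|[? _ _]|[_ _ _ _ links]] := pcm_inv IH; try lia.
by have [/(flag_link_nsurface (flag_linkS flY Yh Dh))|] := links _ Yh.
Qed.

Lemma flag_link_border k Y : fl k Y -> border k Y = Y `&` D.
Proof.
move=> flY; apply/seteqP; split=> h [Yh].
  move=> ns; split=> //; apply: contrapT => nDh; apply: ns.
  exact: flag_link_interior_surface.
by move=> Dh; split=> //; exact/flag_link_nsurface/flag_linkS.
Qed.

(** The border of [Y] consists of the border elements of [X] in [Y], so it is a
    surface by [flag_link_border_surface], and the link in [Y] of each of its
    elements is again the link of a border flag, one dimension lower. *)
Lemma flag_link_smooth k Y : fl k Y -> smooth_pcm k Y.
Proof.
have [N] : exists N : nat, k <= N%:Z by exists (absz k); lia.
elim: N k Y => [|N IH] k Y leN flY; have pY := flag_link_pcm flY.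
  by apply: smooth_pcm_small pY; lia.
have [[? _ _]|[? _ _]|[k1 rY cY bY links]] := pcm_inv pY;
  try by apply: smooth_pcm_small pY; lia.
apply: smooth_pcm_ge1 => //; rewrite (flag_link_border flY).
- by left; exact: flag_link_border_surface.
- by move=> h [Yh Dh]; apply: IH; [lia|exact: flag_linkS].
- move=> h Yh nDh; apply: flag_link_interior_surface => // Dh.
  exact: nDh.
Qed.

Lemma smooth_pcm_of_flag_links : finite_set X -> smooth_pcm n X.
Proof.
move=> fX; have [[? _ _]|[? _ _]|[_ rX cX bX links]] := pcm_inv pX; try lia.
apply: smooth_pcm_ge1 => //; first by lia.
- right; apply: separated_components; [|lia|].
    by apply: sub_finite_set fX => x [].
  by move=> h Dh; have -> : n - 1 - 1 = n - 2; [lia|exact: border_link].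
- by move=> h Dh; exact/flag_link_smooth/flag_link1.
- by move=> h Xh nDh; apply: contrapT => ns; apply: nDh.
Qed.

End FlagLinks.

(** * Rank one *)

Lemma pair_partition (s : seq T) : uniq s -> ~~ odd (size s) ->
  exists F : set (set T),
    [/\ [set` s] = \bigcup_(S in F) S, trivIset F id &
        forall S, F S -> exists x y,
          [/\ x \in s, y \in s, x <> y & S = [set x; y]]].
Proof.
have [N] := ubnP (size s); elim: N s => // N IH [|x [|y s]] //=.
  by move=> _ _ _; exists set0; split=> //; rewrite bigcup_set0 set_nil.
move=> sN /and3P[]; rewrite inE negb_or => /andP[xy xs] ys us.
rewrite negbK => es.
have [||//|F [sE tF pF]] := IH s; [lia|by []|].
have FS S z : F S -> S z -> z \in s.
  by move=> FS Sz; have : [set` s] z by rewrite sE; exists S.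
exists ([set x; y] |` F); split.
- rewrite bigcup_setU1 -sE; apply/seteqP; split=> z /=; rewrite !inE.
    by case/or3P=> [/eqP->|/eqP->|->]; [left; left|left; right|right].
  by case=> [[->|->]|->]; rewrite ?eqxx ?orbT.
- move=> S S' [->|FS1] [->|FS2] //; last exact: tF.
    move=> [z [zxy /(FS _ _ FS2) zs]].
    by case: zxy zs => ->; rewrite ?(negPf xs) ?(negPf ys).
  move=> [z [/(FS _ _ FS1) zs zxy]].
  by case: zxy zs => ->; rewrite ?(negPf xs) ?(negPf ys).
- move=> S [->|/pF[u [v [us' vs uv ->]]]].
    by exists x, y; split; rewrite // ?inE ?eqxx ?orbT //; exact/eqP.
  by exists u, v; split; rewrite // !inE ?us' ?vs ?orbT.
Qed.

(** The handshake lemma: the sum counts every edge of the graph [r] twice. *)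
Lemma handshake (r : rel T) (s : seq T) : symmetric r -> irreflexive r ->
  ~~ odd (\sum_(x <- s) count (r x) s).
Proof.
move=> sr ir; elim: s => [|a s IH]; first by rewrite big_nil.
rewrite big_cons /= ir add0n big_split /= addnA.
have -> : (\sum_(x <- s) r x a)%N = count (r a) s.
  rewrite -sum1_count [RHS]big_mkcond /=; apply: eq_bigr => x _.
  by rewrite sr; case: (r a x).
by rewrite addnn oddD odd_double.
Qed.

Lemma count_mem_set (s t : seq T) (A : set T) : uniq s -> uniq t ->
  [set` t] = A -> A `<=` [set` s] -> count (fun y => `[<A y>]) s = size t.
Proof.
move=> us ut tA As; rewrite -size_filter; apply/perm_size/uniq_perm => //.
  exact: filter_uniq.
move=> y; rewrite mem_filter; apply/andP/idP => [[/asboolP]|yt].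
  by rewrite -tA.
have Ay : A y by rewrite -tA.
by split; [exact/asboolP|exact: As].
Qed.

(** The link of an element of a [1]-PCM has one point on the border and two
    points elsewhere, so by [handshake] the border has an even number of
    elements.  Any grouping of these into pairs is a separated union of
    [0]-surfaces when the border is an antichain. *)
Lemma smooth_pcm1 X : finite_set X -> pcm 1 X ->
  (forall x y, border 1 X x -> border 1 X y -> (x >=< y)%O -> x = y) ->
  smooth_pcm 1 X.
Proof.
move=> fX pX anti; have [[]//|[]//|[_ rX cX bX links]] := pcm_inv pX.
rewrite subrr in links.
have [s us sX] : exists2 s, uniq s & X = [set` s].
  have /finite_seqP[s sX] := fX; exists (undup s); first exact: undup_uniq.
  by rewrite sX; apply/seteqP; split=> x /=; rewrite mem_undup.
pose r x y := `[< [/\ X x, X y, x <> y & (x >=< y)%O] >].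
pose b x := `[< border 1 X x >].
have sr : symmetric r.
  move=> x y; apply/asboolP/asboolP => -[? ? ne c];
    by split=> //; [move=> e; exact: ne|rewrite comparable_sym].
have ir : irreflexive r by move=> x; apply/asboolP => -[].
have cb x : x \in s -> (count (r x) s + b x = 2)%N.
  move=> xs; have Xx : X x by rewrite sX.
  have rE : r x =1 (fun y => `[< theta_sq X x y >]).
    move=> y; apply/asboolP/asboolP => [[_ Xy ne c]|/theta_sqP[Xy ne c]].
      apply/theta_sqP; split=> //; first by move=> e; exact: ne.
      by rewrite comparable_sym.
    by split=> //; [move=> e; exact: ne|rewrite comparable_sym].
  rewrite (eq_count rE).
  have sub : theta_sq X x `<=` [set` s] by rewrite -sX; exact: theta_sq_sub.
  have [bx|nbx] := boolP (b x).
    have [_ ns] := asboolP _ bx; rewrite subrr in ns.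
    have [//|px] := links _ Xx.
    have [[]//|[_ _ [z zE]]|[]//] := pcm_inv px.
    by rewrite (@count_mem_set s [:: z]) //= zE; apply/seteqP; split=> y /=;
      rewrite inE => /eqP.
  have sx : surface 0 (theta_sq X x).
    apply: contrapT => ns; by move/asboolP: nbx; apply; split.
  have [[]//|[_ [u [v [uvE ne _]]]]|[]//] := surface_inv sx.
  rewrite (@count_mem_set s [:: u; v]) //=.
    by rewrite inE andbT; apply/eqP.
  rewrite uvE; apply/seteqP; split=> y /=; rewrite !inE.
    by case/orP=> /eqP; [left|right].
  by case=> ->; rewrite eqxx ?orbT.
have even_border : ~~ odd (size (seq.filter b s)).
  rewrite size_filter.
  have E : (\sum_(x <- s) count (r x) s + count b s = (size s).*2)%N.
    rewrite -sum1_count (big_mkcond b) -big_split /= big_seq.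
    rewrite (eq_bigr (fun=> 2%N)) => [|x xs]; last first.
      by rewrite -[RHS](cb _ xs); case: (b x).
    by rewrite -big_seq big_const_seq count_predT iter_addn_0 mul2n.
  have := handshake s sr ir.
  have : ~~ odd (size s).*2 by rewrite odd_double.
  by rewrite -E oddD; case: odd.
have [F [FE tF pF]] := pair_partition (filter_uniq b us) even_border.
have bE : border 1 X = [set` seq.filter b s].
  apply/seteqP; split=> x /=; rewrite mem_filter.
    move=> bx; apply/andP; split; first exact/asboolP.
    by have := proj1 bx; rewrite sX.
  by case/andP=> /asboolP.
have inb S z : F S -> S z -> border 1 X z.
  by move=> FS Sz; rewrite bE FE; exists S.
apply: smooth_pcm_ge1 => //.
- right; exists F.
    split=> //; first by rewrite bE.
    move=> S S' FS FS' ne x y Sx S'y; apply/negP => xy; apply: ne.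
    apply: tF => //; exists x; split=> //.
    by rewrite (anti _ _ (inb _ _ FS Sx) (inb _ _ FS' S'y) xy).
  move=> S FS; have [x [y [xb yb ne SE]]] := pF _ FS.
  rewrite subrr; apply: surface_0.
    by apply: CF_order_finite; rewrite SE; exact: finite_set2.
  exists x, y; split=> // /theta_sqP[_ _ xy]; apply: ne.
  by apply: anti xy; rewrite bE.
- move=> h [Xh ns]; rewrite subrr in ns *.
  by have [//|] := links _ Xh; exact: smooth_pcm_small.
- by move=> h Xh nb; apply: contrapT => ns; apply: nb.
Qed.

End PCMs.

(** * Simplicial complexes *)

Section Complexes.
Variables (V : Type) (X : set (set V)).
Hypothesis sX : simplicial_complex X.

(** The empty set is not a simplex; placing it below [X] makes [theta_sq X h]
    the case [g = set0] of [theta_sq_beta_sq]. *)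
Lemma simplicial_beta_sq0 : beta_sq X set0 = X.
Proof.
have [_ smp _] := sX; apply/seteqP; split=> h; first by case=> [[]].
move=> Xh; split; first by split=> //; rewrite subsetEset; exact: sub0set.
by move=> /= e; have [_] := smp _ Xh; rewrite e => -[].
Qed.

Lemma beta_sqP (g h : set V) : beta_sq X g h <-> X h /\ (g < h)%O.
Proof.
split=> [[[Xh gh] /= ne]|[Xh gh]].
  by split=> //; rewrite lt_def gh andbT; apply/eqP.
split; first by split=> //; exact: ltW.
by move=> /= e; move: gh; rewrite e ltxx.
Qed.

(** A complex contains all nonempty subsets of its elements, so intervals of [X]
    are full intervals of the inclusion order. *)
Lemma theta_sq_beta_sq (g h : set V) : beta_sq X g h ->
  theta_sq (beta_sq X g) h = open_interval g h `|` beta_sq X h.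
Proof.
move=> /beta_sqP[Xh gh]; have [_ _ dn] := sX.
apply/seteqP; split=> y.
  move/theta_sqP=> [/beta_sqP[Xy gy] /eqP ne].
  rewrite /Order.comparable !le_eqVlt [h == y]eq_sym (negPf ne) /=.
  by case/orP=> [yh|hy]; [left; exact/andP|right; exact/beta_sqP].
case=> [/andP[gy yh]|/beta_sqP[Xy hy]]; apply/theta_sqP; split.
- apply/beta_sqP; split=> //.
  have /setltP[syh _] := yh; apply: (dn h) => //.
  have /setltP[sgy ngy] := gy; apply/set0P/eqP => y0; apply: ngy.
  by apply/seteqP; split=> //; rewrite y0.
- by move=> e; move: yh; rewrite e ltxx.
- by rewrite lt_comparable.
- by apply/beta_sqP; split=> //; exact: lt_trans hy.
- by move=> e; move: hy; rewrite e ltxx.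
- by rewrite comparable_sym lt_comparable.
Qed.

Lemma simplicial_finite (h : set V) : X h -> finite_set h.
Proof. by have [_ smp _] := sX => /smp[]. Qed.

Lemma simplicial_theta_sq (h : set V) : X h ->
  theta_sq X h = open_interval set0 h `|` beta_sq X h.
Proof. by rewrite -{1 2}simplicial_beta_sq0; exact: theta_sq_beta_sq. Qed.

Lemma simplicial_gt0 (h : set V) : X h -> (set0 < h)%O.
Proof. by rewrite -{1}simplicial_beta_sq0 => /beta_sqP[]. Qed.

(** Otherwise the link of [h] would be the ordinal sum of the boundary of [h]
    and of a surface of the complementary dimension, hence an [(n - 1)]-surface. *)
Lemma border_beta_sq n (h : set V) : border n X h ->
  ~ surface (n - (set_card h)%:Z) (beta_sq X h).
Proof.
move=> [Xh ns] s; apply: ns; rewrite simplicial_theta_sq //.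
have fh := simplicial_finite Xh; have [fX _ _] := sX.
have -> : n - 1 = ((set_card h)%:Z - (set_card (@set0 V))%:Z - 2) +
    (n - (set_card h)%:Z) + 1.
  by rewrite set_card0; lia.
apply: surface_join s.
- by apply: sub_finite_set (finite_subsets fh) => y /andP[_ /setltP[]].
- by apply: sub_finite_set fX => y /beta_sqP[].
- by move=> a b /andP[_ ah] /beta_sqP[_ hb]; exact: lt_trans hb.
- exact/open_interval_surface/simplicial_gt0.
Qed.

(** Here [h] is the top of the flag, and [A] is the link of the rest of the flag
    in the boundary of [h].  Adding [h'] to the flag either takes a link inside
    [A], or, when [h'] is above [h], replaces the top by [h'] and adds to [A]
    the sphere between [h] and [h']. *)
Lemma simplicial_flag_link n k Y : flag_link X n k Y ->
  exists p A (h : set V),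
    [/\ border n X h, finite_set A, surface p A,
        forall a b, A a -> beta_sq X h b -> (a < b)%O &
        Y = A `|` beta_sq X h /\ k = p + (n - (set_card h)%:Z) + 1].
Proof.
have finI (g h : set V) : X h -> finite_set (open_interval g h).
  move=> /simplicial_finite/finite_subsets fh.
  by apply: sub_finite_set fh => y /andP[_ /setltP[]].
elim=> {k Y} [h bh|k Y h' flY [p [A [h [bh fA sA ltA [YE kE]]]]] Yh' bh'].
  have [Xh _] := bh.
  exists ((set_card h)%:Z - (set_card (@set0 V))%:Z - 2).
  exists (open_interval set0 h), h.
  split=> //; [exact: finI| | |split; [exact: simplicial_theta_sq|]].
  - exact/open_interval_surface/simplicial_gt0/Xh/simplicial_finite.
  - by move=> a b /andP[_ ah] /beta_sqP[_ hb]; exact: lt_trans hb.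
  - by rewrite set_card0; lia.
rewrite YE in Yh' *; case: Yh' => [Ah'|Bh'].
  exists (p - 1), (theta_sq A h'), h; split=> //.
  - exact: sub_finite_set (@theta_sq_sub _ _ _ _) fA.
  - exact: surface_theta_sq.
  - by move=> a b /theta_sq_sub; exact: ltA.
  - split; last by lia.
    by rewrite theta_sqU_lower // => b; exact: ltA.
have /beta_sqP[Xh' hh'] := Bh'.
have ltAI a b : A a -> open_interval h h' b -> (a < b)%O.
  move=> Aa; have := theta_sq_beta_sq Bh' => E.
  move=> Ib; apply: ltA => //.
  by apply: (@theta_sq_sub _ _ _ h'); rewrite E; left.
exists (p + ((set_card h')%:Z - (set_card h)%:Z - 2) + 1).
exists (A `|` open_interval h h'), h'.
split=> //.
- by rewrite finite_setU; split=> //; exact: finI.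
- apply: surface_join => //; first exact: finI.
  exact/open_interval_surface/hh'/simplicial_finite.
- move=> a b [Aa|/andP[_ ah]] /beta_sqP[Xb hb]; last exact: lt_trans hb.
  by apply: ltA => //; apply/beta_sqP; split=> //; exact: lt_trans hb.
- split; last by lia.
  rewrite theta_sqU_upper; last by move=> a Aa; exact: ltA.
  by rewrite theta_sq_beta_sq // setUA.
Qed.

Lemma simplicial_flag_link_nsurface n k Y :
  flag_link X n k Y -> ~ surface k Y.
Proof.
move=> /simplicial_flag_link[p [A [h [bh _ sA ltA [-> ->]]]]] sY.
apply: (border_beta_sq bh).
have -> : n - (set_card h)%:Z = p + (n - (set_card h)%:Z) + 1 - p - 1 by lia.
exact: surface_join_cancel sY.
Qed.

(** The link of a simplex with two vertices [a] and [b] contains both of them,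
    so it is not a single point and must be a [0]-surface. *)
Lemma simplicial_border1 (h : set V) : pcm 1 X -> border 1 X h ->
  is_subset1 h.
Proof.
move=> pX [Xh]; rewrite subrr => ns a b ha hb; apply: contrapT => nab.
have [[]//|[]//|[_ _ _ _ /(_ _ Xh)]] := pcm_inv pX.
rewrite subrr => -[//|ph].
have [[]//|[_ _ [z zE]]|[]//] := pcm_inv ph.
have vertex c c' : h c -> h c' -> c <> c' -> theta_sq X h [set c].
  move=> hc hc' ne; have [_ _ dn] := sX; apply/theta_sqP.
  have sc : [set c] `<=` h by move=> x ->.
  split; first by apply: dn Xh sc _; exists c.
    by move=> e; apply: ne; move: hc'; rewrite -e => ->.
  by apply/orP; left; rewrite subsetEset.
have := vertex _ _ ha hb nab; have nba : b <> a by move=> e; exact: nab.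
have := vertex _ _ hb ha nba.
rewrite zE /= => <- ab; apply: nab; have : [set b] a by rewrite -ab.
by [].
Qed.

End Complexes.

Theorem theorem5 :
  (forall (d : Order.disp_t) (T : porderType d) (X : set T) (n : int),
     pcm n X -> n = -1 \/ n = 0 -> smooth_pcm n X)
  /\
  (forall (V : Type) (X : set (set V)) (n : int),
     pcm n X -> simplicial_complex X -> n = 1 -> smooth_pcm n X)
  /\
  (forall (V : Type) (X : set (set V)) (n : int),
     pcm n X -> simplicial_complex X -> 2 <= n ->
     (forall h : set V, border n X h ->
        surface (n - 2) (theta_sq (border n X) h)) ->
     smooth_pcm n X).
Proof.
split=> [d T X n pX n0|]; first by apply: smooth_pcm_small pX; lia.
split=> V X n pX sX; have [fX smp _] := sX.
  move=> n1; rewrite n1 in pX *; apply: smooth_pcm1 => // x y bx by_ xy.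
  have [[Xx _] [Xy _]] := (bx, by_).
  have x1 := simplicial_border1 sX pX bx.
  have y1 := simplicial_border1 sX pX by_.
  have [[_ [a xa]] [_ [b yb]]] := (smp _ Xx, smp _ Xy).
  move: xy => /orP[]; rewrite subsetEset => sub; apply/seteqP; split=> // c.
    by move=> yc; rewrite (y1 _ _ yc (sub _ xa)).
  by move=> xc; rewrite (x1 _ _ xc (sub _ yb)).
move=> n2 bl; apply: smooth_pcm_of_flag_links => //.
exact: simplicial_flag_link_nsurface.
Qed.
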